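(* The space $M(\mathbb R(X,Y))$ of $\mathbb R$-places of the rational function field $\mathbb R(X,Y)$ in two variables over $\mathbb R$ is not metrizable.
   Context: An order $P$ of a field $K$ is identified with its set of positive elements. For an order $P$ of $K$ put $A(P)=\{a\in K:\exists q\in\mathbb Q^+,\ q\pm a\in P\}$, a valuation ring of $K$ with maximal ideal $I(P)=\{a\in K:\forall q\in\mathbb Q^+,\ q\pm a\in P\}$. The residue field $k(P)=A(P)/I(P)$ inherits an Archimedean order from $P$, so it embeds uniquely as an ordered field in $\mathbb R$. The $\mathbb R$-place $\lambda_K(P):K\to\mathbb R\cup\{\infty\}$ sends $a\in A(P)$ to its residue class viewed in $\mathbb R$, and $a\notin A(P)$ to $\infty$. $\mathcal X(K)$ is the set of all orders of $K$, with the topology having as subbase the Harrison sets $H_K(a)=\{P\in\mathcal X(K): a\in P\}$, $a\in K\setminus\{0\}$. $M(K)$ is the set of all $\mathbb R$-places of $K$, with the quotient topology from the surjection $\lambda_K:\mathcal X(K)\to M(K)$. *)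

(* Defs.v *)
From HB Require Import structures.
From mathcomp Require Import all_boot all_order all_algebra.
From mathcomp Require Import ring lra.
From mathcomp Require Import all_classical all_reals topology.

Set Implicit Arguments.
Unset Strict Implicit.
Unset Printing Implicit Defensive.

Import Order.TTheory GRing.Theory Num.Theory.

Local Open Scope classical_set_scope.
Local Open Scope ring_scope.
Local Open Scope quotient_scope.

(* Positivity is strict: 0 does not belong to an order. *)
Record field_order (K : fieldType) := FieldOrder {
  pos :> K -> Prop;
  posD : forall a b, pos a -> pos b -> pos (a + b);
  posM : forall a b, pos a -> pos b -> pos (a * b);
  pos0N : ~ pos 0;
  pos_total : forall a, a != 0 -> pos a \/ pos (- a) }.

HB.instance Definition _ (K : fieldType) := gen_eqMixin (field_order K).
HB.instance Definition _ (K : fieldType) := gen_choiceMixin (field_order K).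

Definition harrison (K : fieldType) (a : K) : set (field_order K) :=
  [set P : field_order K | P a].

HB.instance Definition _ (K : fieldType) :=
  isSubBaseTopological.Build (field_order K)
    [set harrison a | a in [set a : K | a != 0]] id.

(* The field K carrying the order relation attached to P; it makes the library
   of ordered fields (and lra) available for the proofs below. *)
Definition ordered_by (K : fieldType) (P : field_order K) : Type := K.

Section OrderedBy.
Variables (K : fieldType) (P : field_order K).
Local Notation F := (ordered_by P).

HB.instance Definition _ := GRing.Field.on F.

Let lt (x y : F) : bool := `[< P (y - x) >].
Let le (x y : F) : bool := (x == y) || lt x y.
Let norm (x : F) : F := if lt 0 x then x else - x.

Let lt0P (x : F) : reflect (P x) (lt 0 x).
Proof. by rewrite /lt subr0; exact: asboolP. Qed.

Let lt0_add x y : lt 0 x -> lt 0 y -> lt 0 (x + y).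
Proof. by move=> /lt0P Px /lt0P Py; apply/lt0P; exact: posD. Qed.

Let lt0_mul x y : lt 0 x -> lt 0 y -> lt 0 (x * y).
Proof. by move=> /lt0P Px /lt0P Py; apply/lt0P; exact: posM. Qed.

Let lt0N x : lt x 0 = lt 0 (- x).
Proof. by rewrite /lt subr0 sub0r. Qed.

Let lt0_ngt0 x : lt 0 x -> ~~ lt x 0.
Proof.
rewrite lt0N => /lt0P Px; apply/negP => /lt0P PNx.
by apply: (@pos0N _ P); rewrite -(subrr x); exact: posD.
Qed.

Let sub_gt0 x y : lt 0 (y - x) = lt x y.
Proof. by rewrite /lt subr0. Qed.

Let lt0_total x : x != 0 -> lt 0 x || lt x 0.
Proof.
rewrite lt0N => /(@pos_total _ P) [Px|Px]; apply/orP; [left|right];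
  exact/lt0P.
Qed.

Let normN x : norm (- x) = norm x.
Proof.
rewrite /norm; have [->|x0] := eqVneq x 0; first by rewrite !oppr0.
rewrite -lt0N opprK; have := @lt0_ngt0 x; have := lt0_total x0.
by case: (lt 0 x); case: (lt x 0) => //= _ /(_ isT).
Qed.

Let ge0_norm x : le 0 x -> norm x = x.
Proof.
by rewrite /le /norm => /orP[/eqP <-|-> //]; rewrite oppr0 if_same.
Qed.

Let le_def x y : le x y = (x == y) || lt x y. Proof. by []. Qed.

HB.instance Definition _ := Num.IntegralDomain_isLtReal.Build F
  lt0_add lt0_mul lt0_ngt0 sub_gt0 lt0_total normN ge0_norm le_def.

Lemma pos_gt0 (x : F) : P x <-> 0 < x.
Proof. by split=> /lt0P. Qed.

End OrderedBy.

Section RationalApproximation.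
Variables (F : realFieldType) (R : realType).

(* a and r admit common rational approximations to any precision. *)
Definition approx (a : F) (r : R) := forall e : rat, 0 < e ->
  exists q : rat, `|a - ratr q| < ratr e /\ `|r - ratr q| < ratr e.

Lemma approx_exists (a : F) (q : rat) : `|a| < ratr q -> exists r, approx a r.
Proof.
rewrite ltr_norml => /andP[qa aq].
pose S : set R := [set x | exists2 p : rat, ratr p < a & x = ratr p].
have S0 : S (ratr (- q)) by exists (- q); rewrite // rmorphN.
have Sub : ubound S (ratr q).
  by move=> _ [p pa ->]; rewrite ler_rat -(ler_rat F) ltW // (lt_trans pa).
have Ssup : has_sup S by split; [exists (ratr (- q)) | exists (ratr q)].
exists (sup S) => e e0.
have e20 : 0 < e / 2 by rewrite divr_gt0.
have eS : (0 : R) < ratr (e / 2) by rewrite ltr0q.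
have [_ [p pa ->] pS] := sup_adherent eS Ssup.
have pleS : ratr p <= sup S by apply: ub_le_sup; [exists (ratr q) | exists p].
have e2e : e / 2 < e by rewrite ltr_pdivrMr// ltr_pMr// ltr1n.
exists p; split.
  rewrite gtr0_norm ?subr_gt0// ltNge; apply/negP => h.
  have : S (ratr (p + e / 2)).
    exists (p + e / 2) => //; rewrite rmorphD /=.
    have : (ratr (e / 2) : F) < ratr e by rewrite ltr_rat.
    by move=> ?; lra.
  move=> /(ub_le_sup (ex_intro _ _ Sub)); rewrite rmorphD /=.
  by rewrite leNgt -ltrBlDr pS.
rewrite ger0_norm ?subr_ge0//.
have : (ratr (e / 2) : R) < ratr e by rewrite ltr_rat.
by move=> ?; lra.
Qed.

Lemma approx_ge0 a r : approx a r -> 0 <= a -> 0 <= r.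
Proof.
move=> ar a0; rewrite leNgt; apply/negP => r0.
have nr0 : 0 < - r / 2 by lra.
have [e] := rat_in_itvoo nr0; rewrite in_itv /= => /andP[e0 er].
have {}e0 : (0 : rat) < e by rewrite -(ltr0q R).
have [q [aq rq]] := ar e e0.
have : - ratr e < ratr q :> F.
  by move: aq; rewrite ltr_distl => /andP[_ /(le_lt_trans a0)];
    rewrite -[- _ < _]subr_gt0 opprK.
rewrite -rmorphN ltr_rat -(ltr_rat R) rmorphN => qe.
have {}qe : - ratr e < ratr q :> R := qe.
move: qe rq er; rewrite ltr_distl => + /andP[].
move: (ratr e : R) (ratr q : R) => x y h1 h2 h3 h4.
have yr : y + y < r by lra.
have : r < y + y by lra.
by rewrite ltNge (ltW yr).
Qed.

Lemma approx_rat q : approx (ratr q) (ratr q).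
Proof.
move=> e e0; exists q; rewrite !subrr !normr0.
by rewrite !ltr0q.
Qed.

Lemma approxN a r : approx a r -> approx (- a) (- r).
Proof.
move=> ar e /ar[q [aq rq]]; exists (- q).
by rewrite !rmorphN -!opprD !normrN.
Qed.

Lemma approxD a r b s : approx a r -> approx b s -> approx (a + b) (r + s).
Proof.
move=> ar bs e e0; have e20 : 0 < e / 2 by rewrite divr_gt0.
have [p [ap rp]] := ar _ e20; have [q [bq sq]] := bs _ e20.
exists (p + q); rewrite (splitr e); split; rewrite !(rmorphD ratr) opprD addrACA;
  by rewrite (le_lt_trans (ler_normD _ _))// ltrD.
Qed.

Lemma approx_bound a r : approx a r -> exists2 n : rat,
  1 <= n & `|a| <= ratr n /\ `|r| <= ratr n.
Proof.
have bd (L : realFieldType) (x : L) (q : rat) :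
    `|x - ratr q| < ratr 1 -> `|x| <= ratr (`|q| + 1).
  move=> xq; have -> : ratr (`|q| + 1) = ratr 1 + `|ratr q| :> L.
    by rewrite -ratr_norm -(rmorphD ratr) addrC.
  rewrite -[in `|x|](subrK (ratr q) x) (le_trans (ler_normD _ _))// lerD//.
  exact: ltW.
move=> /(_ 1 ltr01)[q [aq rq]]; exists (`|q| + 1); first by rewrite lerDr.
by split; exact: bd.
Qed.

Lemma approxM a r b s : approx a r -> approx b s -> approx (a * b) (r * s).
Proof.
move=> ar bs e e0.
have [m m1 [am rm]] := approx_bound ar; have [n n1 [bn sn]] := approx_bound bs.
have mn0 : 0 < m + n + 1 by lra.
pose d := Num.min 1 (e / (m + n + 1)).
have d0 : 0 < d by rewrite lt_min ltr01 divr_gt0.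
have [p [ap rp]] := ar _ d0; have [q [bq sq]] := bs _ d0.
have d1 : d <= 1 by rewrite ge_min lexx.
have de : d * (m + n + 1) <= e by rewrite -ler_pdivlMr// ge_min lexx orbT.
have bd (L : realFieldType) (x y : L) : `|x| <= ratr m -> `|y| <= ratr n ->
    `|x - ratr p| < ratr d -> `|y - ratr q| < ratr d ->
    `|x * y - ratr (p * q)| < ratr e.
  move=> xm yn xp yq.
  have -> : x * y - ratr (p * q) = x * (y - ratr q) + y * (x - ratr p)
      - (x - ratr p) * (y - ratr q) by rewrite (rmorphM ratr); ring.
  have dd0 : 0 < ratr d :> L by rewrite ltr0q.
  have h1 : `|x * (y - ratr q)| <= ratr m * ratr d.
    by rewrite normrM ler_pM// ltW.
  have h2 : `|y * (x - ratr p)| <= ratr n * ratr d.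
    by rewrite normrM ler_pM// ltW.
  have h3 : `|(x - ratr p) * (y - ratr q)| < ratr d.
    rewrite normrM (@lt_le_trans _ _ (ratr d * ratr d))//.
      by rewrite ltr_pM.
    by rewrite ler_piMl ?(ltW dd0)// -(rmorph1 ratr) ler_rat.
  have : ratr (d * (m + n + 1)) <= ratr e :> L by rewrite ler_rat.
  apply: lt_le_trans; rewrite (rmorphM ratr) !(rmorphD ratr) (rmorph1 ratr).
  rewrite [ltRHS]mulrC [ltRHS]mulrDl mul1r [in ltRHS](mulrDl (ratr m)).
  rewrite (le_lt_trans (ler_normB _ _)) // ler_ltD//.
  by rewrite (le_trans (ler_normD _ _))// lerD.
by exists (p * q); split; exact: bd.
Qed.

Lemma approx_uniq a r s : approx a r -> approx a s -> r = s.
Proof.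
move=> ar as_; apply/eqP; rewrite -subr_eq0; apply/eqP.
have rs := approxD ar (approxN as_); have sr := approxD as_ (approxN ar).
apply/eqP; rewrite eq_le subr_ge0 subr_le0 -(subr_ge0 r s) -(subr_ge0 s r).
by rewrite (approx_ge0 rs) ?(approx_ge0 sr)// subrr.
Qed.

Lemma approx_small a : (forall e : rat, 0 < e -> `|a| < ratr e) -> approx a 0.
Proof.
move=> h e e0; exists 0; rewrite rmorph0 (rmorph0 ratr) !subr0 normr0 ltr0q.
by split => //; exact: h.
Qed.

Lemma approx0_small a (e : rat) : approx a 0 -> 0 < e -> `|a| < ratr e.
Proof.
move=> a0 e0; have e20 : 0 < e / 2 by rewrite divr_gt0.
have [q [aq]] := a0 _ e20; rewrite sub0r normrN -ratr_norm ltr_rat => qe.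
rewrite -(subrK (ratr q) a) (le_lt_trans (ler_normD _ _))//.
by rewrite [in ltRHS](splitr e) (rmorphD ratr) ltrD// -ratr_norm ltr_rat.
Qed.

End RationalApproximation.

Section Residue.
Variables (K : fieldType) (P : field_order K).
Local Notation F := (ordered_by P).

(* A(P) *)
Definition bounded_elt : {pred K} := fun a =>
  `[< exists2 q : rat, 0 < q & P (ratr q + a) /\ P (ratr q - a) >].

Lemma pos_norm_lt (a : F) (x : F) :
  (P (x + a) /\ P (x - a)) <-> `|a| < x.
Proof.
rewrite !pos_gt0 ltr_norml; split=> [[h1 h2]|/andP[h1 h2]].
  by rewrite -subr_gt0 opprK addrC h1 -subr_gt0 h2.
by rewrite subr_gt0 h2 addrC -[x]opprK subr_gt0.
Qed.

Lemma bounded_eltP (a : F) :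
  reflect (exists2 q : rat, 0 < q & `|a| < ratr q) (bounded_elt a).
Proof.
by apply: (iffP (asboolP _)) => -[q q0 /pos_norm_lt aq]; exists q.
Qed.

Lemma bounded_elt_subring : subring_closed bounded_elt.
Proof.
split=> [|a b|a b].
- apply/(bounded_eltP 1); exists 2 => //.
  by rewrite normr1 -(rmorph1 ratr) ltr_rat.
- move=> /(bounded_eltP a)[p p0 ap] /(bounded_eltP b)[q q0 bq].
  apply/(bounded_eltP (a - b : F)); exists (p + q); first exact: addr_gt0.
  by rewrite (rmorphD ratr) (le_lt_trans (ler_normB _ _)) // ltrD.
- move=> /(bounded_eltP a)[p p0 ap] /(bounded_eltP b)[q q0 bq].
  apply/(bounded_eltP (a * b : F)); exists (p * q); first exact: mulr_gt0.
  by rewrite (rmorphM ratr) normrM ltr_pM.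
Qed.

HB.instance Definition _ := GRing.isSubringClosed.Build K bounded_elt
  bounded_elt_subring.

Definition valuation_ring : Type := {a : K | a \in bounded_elt}.

HB.instance Definition _ := SubType.on valuation_ring.
HB.instance Definition _ := Choice.on valuation_ring.
HB.instance Definition _ :=
  [SubChoice_isSubComNzRing of valuation_ring by <:].

(* I(P) *)
Definition infinitesimal_elt : {pred valuation_ring} := fun a =>
  `[< forall q : rat, 0 < q -> P (ratr q + val a) /\ P (ratr q - val a) >].

Lemma infinitesimal_eltP (a : valuation_ring) :
  reflect (forall q : rat, 0 < q -> `|val a : F| < ratr q)
          (infinitesimal_elt a).
Proof.
by apply: (iffP (asboolP _)) => h q /h/pos_norm_lt.
Qed.

Lemma infinitesimal_elt_idealr : idealr_closed infinitesimal_elt.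
Proof.
split.
- apply/infinitesimal_eltP => q q0.
  by rewrite rmorph0 normr0 ltr0q.
- apply/negP => /infinitesimal_eltP /(_ 1 ltr01).
  by rewrite rmorph1 (rmorph1 ratr) normr1 ltxx.
move=> c a b /infinitesimal_eltP ha /infinitesimal_eltP hb.
apply/infinitesimal_eltP => q q0.
have [n n0 cn] := bounded_eltP _ (valP c).
have q2 : 0 < q / 2 by rewrite divr_gt0.
have ca : `|(val c : F) * (val a : F)| < ratr (q / 2).
  rewrite -[q / 2](divfK (lt0r_neq0 n0)) mulrC (rmorphM ratr) normrM.
  by rewrite ltr_pM// ha// divr_gt0.
rewrite (splitr q) (rmorphD ratr) rmorphD rmorphM.
exact: le_lt_trans (ler_normD (_ : F) _) (ltrD ca (hb _ q2)).
Qed.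

HB.instance Definition _ := isIdealr.Build valuation_ring infinitesimal_elt
  infinitesimal_elt_idealr.

(* k(P) *)
Definition residue_field : Type := {ideal_quot infinitesimal_elt}.

HB.instance Definition _ := Quotient.on residue_field.
HB.instance Definition _ := GRing.ComNzRing.on residue_field.

Definition residue (a : valuation_ring) : residue_field := \pi a.

HB.instance Definition _ := GRing.RMorphism.copy residue
  (\pi_({ideal_quot infinitesimal_elt}) :
     valuation_ring -> {ideal_quot infinitesimal_elt}).

Lemma residue_eq0 (a : valuation_ring) :
  (residue a == 0) = infinitesimal_elt a.
Proof.
have := Quotient.idealrBE infinitesimal_elt a 0.
by rewrite subr0 -(rmorph0 residue) => /esym.
Qed.

Lemma residue_surj (x : residue_field) : exists a, x = residue a.
Proof. by exists (repr x); rewrite /residue reprK. Qed.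

Definition residue_inv (x : residue_field) : residue_field :=
  xget 0 [set y | y * x = 1].

Lemma residue_mulVf (x : residue_field) : x != 0 -> residue_inv x * x = 1.
Proof.
have [a ->] := residue_surj x; rewrite residue_eq0.
move=> /infinitesimal_eltP/existsNP[q /not_implyP[q0 /negP]].
rewrite -leNgt => qa; have a0 : (val a : F) != 0.
  by rewrite -normr_gt0 (lt_le_trans _ qa)// ltr0q.
have aV : bounded_elt (val a)^-1.
  apply/(bounded_eltP (val a : F)^-1); exists (q^-1 + 1).
    by rewrite addr_gt0 ?invr_gt0.
  rewrite normfV (rmorphD ratr) (rmorph1 ratr) ltr_pwDr//.
  by rewrite (fmorphV ratr) lef_pV2// posrE ?normr_gt0// ltr0q.
pose b : valuation_ring := exist _ (val a)^-1 aV.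
rewrite /residue_inv; case: xgetP => [y _ -> //|/(_ (residue b))] []/=.
rewrite -rmorphM -(rmorph1 residue); congr residue; apply: val_inj.
by rewrite rmorphM rmorph1 /= mulVf.
Qed.

Lemma residue_inv0 : residue_inv 0 = 0.
Proof.
rewrite /residue_inv; case: xgetP => [y _ /= /eqP|//].
by rewrite mulr0 eq_sym oner_eq0.
Qed.

HB.instance Definition _ :=
  GRing.ComNzRing_isField.Build residue_field residue_mulVf residue_inv0.

(* The order inherited by the residue field. *)
Definition residue_pos (x : residue_field) : Prop :=
  x != 0 /\ exists2 a : valuation_ring, P (val a) & x = residue a.

Lemma residue_posD x y :
  residue_pos x -> residue_pos y -> residue_pos (x + y).
Proof.
move=> [x0 [a Pa xa]] [y0 [b Pb yb]]; split; last first.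
  by exists (a + b); [rewrite rmorphD; exact: posD|rewrite xa yb -rmorphD].
apply: contra x0; rewrite xa yb -rmorphD !residue_eq0.
move=> /infinitesimal_eltP ab; apply/infinitesimal_eltP => q /ab.
move: Pa Pb => /(pos_gt0 (val a : F)) Pa /(pos_gt0 (val b : F)) Pb.
apply: le_lt_trans; rewrite rmorphD.
rewrite (gtr0_norm Pa) (gtr0_norm (addr_gt0 Pa Pb)).
by rewrite lerDl ltW.
Qed.

Lemma residue_posM x y :
  residue_pos x -> residue_pos y -> residue_pos (x * y).
Proof.
move=> [x0 [a Pa xa]] [y0 [b Pb yb]]; split; first by rewrite mulf_neq0.
by exists (a * b); [rewrite rmorphM; exact: posM|rewrite xa yb -rmorphM].
Qed.

Lemma residue_pos0N : ~ residue_pos 0.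
Proof. by case; rewrite eqxx. Qed.

Lemma residue_pos_total x : x != 0 -> residue_pos x \/ residue_pos (- x).
Proof.
move=> x0; have [a xa] := residue_surj x.
have a0 : val a != 0.
  apply: contra x0 => /eqP a0; rewrite xa -(rmorph0 residue).
  by apply/eqP; congr residue; apply: val_inj; rewrite a0.
have [Pa|Pa] := @pos_total _ P _ a0; [left|right]; split => //.
- by exists a.
- by rewrite oppr_eq0.
- by exists (- a); rewrite ?rmorphN // xa.
Qed.

Definition residue_order : field_order residue_field :=
  FieldOrder residue_posD residue_posM residue_pos0N residue_pos_total.

Lemma bounded_ratr (p : rat) : bounded_elt (ratr p).
Proof.
apply/(bounded_eltP (ratr p : F)); exists (`|p| + 1).
  by rewrite ltr_wpDl.
by rewrite -ratr_norm ltr_rat ltrDl.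
Qed.

Definition valuation_ratr (p : rat) : valuation_ring :=
  exist _ (ratr p) (bounded_ratr p).

Lemma valuation_ratrE p :
  valuation_ratr p * (denq p)%:~R = (numq p)%:~R.
Proof.
have h : (ratr p : F) * (denq p)%:~R = (numq p)%:~R.
  rewrite -(@ratr_int F (numq p)) -(@ratr_int F (denq p)) -(rmorphM ratr).
  by rewrite -[X in X * _]divq_num_den divfK// intr_eq0 denq_eq0.
by apply: val_inj; rewrite rmorphM !rmorph_int; exact: h.
Qed.

End Residue.

Section Place.
Variables (R : realType) (K : fieldType) (P : field_order K).
Local Notation F := (ordered_by P).

Definition ordered_embedding (f : residue_field P -> R) : Prop :=
  forall x, residue_order P x -> 0 < f x.

Let approximates (x : residue_field P) (r : R) : Prop :=
  exists a, x = residue a /\ approx (val a : F) r.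

Let approximates_ex x : exists r, approximates x r.
Proof.
have [a ->] := residue_surj x; have [q _ /approx_exists] := bounded_eltP _ (valP a).
by move=> /(_ R)[r ar]; exists r, a.
Qed.

Let approximates_uniq x r s : approximates x r -> approximates x s -> r = s.
Proof.
move=> [a [-> ar]] [b [/eqP + bs]]; rewrite -subr_eq0 -rmorphB residue_eq0.
move=> /infinitesimal_eltP/(approx_small R) ab.
apply: approx_uniq ar _; have := approxD bs ab; rewrite addr0; congr approx.
by rewrite rmorphB addrC subrK.
Qed.

Let f (x : residue_field P) : R := xget 0 (approximates x).

Let fP x : approximates x (f x).
Proof. by have [r xr] := approximates_ex x; exact: (xgetPex 0 (ex_intro _ r xr)). Qed.

Let f_eq x r : approximates x r -> f x = r.
Proof. exact: approximates_uniq. Qed.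

Let f_zmod : zmod_morphism f.
Proof.
move=> x y; apply: f_eq.
have [[a [xa ar]] [b [yb bs]]] := (fP x, fP y).
exists (a - b); split; first by rewrite xa yb -rmorphB.
by rewrite rmorphB; apply: approxD => //; exact: approxN.
Qed.

Let f_monoid : monoid_morphism f.
Proof.
split=> [|x y]; apply: f_eq.
  exists 1; rewrite !rmorph1; split => //.
  by have := approx_rat F R 1; rewrite !rmorph1.
have [[a [xa ar]] [b [yb bs]]] := (fP x, fP y).
exists (a * b); split; first by rewrite xa yb -rmorphM.
by rewrite rmorphM; exact: approxM.
Qed.

HB.instance Definition _ := GRing.isZmodMorphism.Build _ _ f f_zmod.
HB.instance Definition _ := GRing.isMonoidMorphism.Build _ _ f f_monoid.

Lemma residue_embedding_exists :
  exists g : {rmorphism residue_field P -> R}, ordered_embedding g.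
Proof.
exists f => x [x0 [a Pa xa]]; rewrite lt_def fmorph_eq0 x0 /=.
have [q _ /approx_exists] := bounded_eltP _ (valP a); move=> /(_ R)[r ar].
have -> : f x = r by apply: f_eq; exists a.
by apply: approx_ge0 ar _; apply: ltW; exact/pos_gt0.
Qed.

Let embedding_approximates (g : {rmorphism residue_field P -> R}) :
  ordered_embedding g -> forall x, approximates x (g x).
Proof.
move=> gP x; have [a [xa ar]] := fP x; exists a; split => // e e0.
have e20 : 0 < e / 2 by rewrite divr_gt0.
have g_ge0 b : P (val b) -> 0 <= g (residue b).
  move=> Pb; have [->|b0] := eqVneq (residue b) 0; first by rewrite rmorph0.
  by apply/ltW/gP; split => //; exists b.
have g_ratr p : g (residue (valuation_ratr P p)) = ratr p.
  have := congr1 (g \o @residue _ P) (valuation_ratrE P p).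
  rewrite /= !rmorphM !rmorph_int /= => h.
  have dn0 : (denq p)%:~R != 0 :> R by rewrite intr_eq0 denq_eq0.
  apply: (mulIf dn0); rewrite h.
  rewrite -(@ratr_int R (numq p)) -(@ratr_int R (denq p)) -(rmorphM ratr).
  by rewrite -[X in X * _]divq_num_den divfK// intr_eq0 denq_eq0.
have [q [aq _]] := ar _ e20; exists q; split.
  by rewrite (lt_le_trans aq)// ler_rat ler_pdivrMr// ler_pMr// ler1n.
move: aq => /pos_norm_lt[h1 h2].
have := g_ge0 (valuation_ratr P (e / 2) + (a - valuation_ratr P q)).
have := g_ge0 (valuation_ratr P (e / 2) - (a - valuation_ratr P q)).
rewrite !(rmorphD, rmorphN) /= !g_ratr -xa => /(_ h2) h3 /(_ h1) h4.
apply: (@le_lt_trans _ _ (ratr (e / 2))).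
  by rewrite ler_norml; apply/andP; split; lra.
by rewrite ltr_rat ltr_pdivrMr// ltr_pMr// ltr1n.
Qed.

Lemma residue_embedding_unique (g h : {rmorphism residue_field P -> R}) :
  ordered_embedding g -> ordered_embedding h -> g =1 h.
Proof.
move=> gP hP x.
by apply: (@approximates_uniq x); exact: embedding_approximates.
Qed.

Definition residue_embedding : {rmorphism residue_field P -> R} :=
  sval (cid residue_embedding_exists).

Lemma residue_embeddingP : ordered_embedding residue_embedding.
Proof. exact: svalP (cid residue_embedding_exists). Qed.

(* The point at infinity of the codomain is None. *)
Definition place (a : K) : option R :=
  omap (fun b : valuation_ring P => residue_embedding (residue b)) (insub a).

End Place.

Section SpaceOfPlaces.
Variables (R : realType) (K : fieldType).

Definition real_place : Type := set_type (range (@place R K)).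

HB.instance Definition _ := Choice.on real_place.

Definition place_of (P : field_order K) : real_place :=
  exist _ (place R P) (mem_set (imageT (@place R K) P)).

Definition order_of_place (l : real_place) : field_order K :=
  s2val (cid2 (set_mem (valP l))).

Lemma order_of_placeK : cancel order_of_place place_of.
Proof. by move=> l; apply: val_inj; exact: s2valP' (cid2 (set_mem (valP l))). Qed.

HB.instance Definition _ :=
  isQuotient.Build (field_order K) real_place order_of_placeK.

Definition space_of_places : topologicalType := quotient_topology real_place.

Lemma open_space_of_places (U : set space_of_places) :
  open U <-> open (place_of @^-1` U).
Proof.
have -> : (place_of : _ -> space_of_places) = \pi_real_place.
  by rewrite unlock.
by split.
Qed.

End SpaceOfPlaces.

Definition metrizable (R : realType) (T : topologicalType) : Prop :=
  exists (M : metricType R) (f : T -> M) (g : M -> T),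
    [/\ cancel f g, cancel g f, continuous f & continuous g].

(* R(X,Y), as the field of fractions of R[X][Y] *)
Definition ratfun2 (R : realType) : fieldType := {fraction {poly {poly R}}}.

(* Main.v *)
(* For a real number a, let P_a and Q_a be the orders of R(X,Y) given by
   0 < Y << X - a << 1 and 0 < X - a << Y << 1: the sign of f is the sign of
   f(x,y) for x near a^+ and then y near 0^+, respectively for y near 0^+ and
   then x near a^+. The function Y / (X - a) vanishes at the place of P_a but
   not at the place of Q_a, so these places are distinct. Writing f = Y^m q
   with q(X,0) != 0, the sign of f in both P_a and Q_a is the sign of q(a,0) as
   soon as q(a,0) != 0; hence P_a and Q_a both converge to P_c as a -> c^+.
   If a metric d induced the topology of M(R(X,Y)), then
   g(a) = d(place of P_a, place of Q_a) would be a positive function on R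
   tending to 0 at c^+ for every c. Then every {g < 1/n} has dense interior,
   and Baire's theorem gives a zero of g. *)
Require Import Defs.
From mathcomp Require Import all_boot all_order all_algebra.
From mathcomp Require Import ring lra polyXY.
From mathcomp Require Import all_classical all_reals topology normedtype.
From mathcomp Require Import sequences derive finmap interval_inference.

Set Implicit Arguments.
Unset Strict Implicit.
Unset Printing Implicit Defensive.

Import Order.TTheory GRing.Theory Num.Theory.
Import numFieldNormedType.Exports.

Local Open Scope classical_set_scope.
Local Open Scope ring_scope.

Local Notation "x %:F" := (@tofrac _ x).

(** * Extension of an order from a domain to its field of fractions *)

Section FractionOrder.
Variables (D : idomainType) (Q : D -> Prop).
Hypothesis QD : forall a b, Q a -> Q b -> Q (a + b).
Hypothesis QM : forall a b, Q a -> Q b -> Q (a * b).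
Hypothesis Q0N : ~ Q 0.
Hypothesis Q_total : forall a, a != 0 -> Q a \/ Q (- a).

Lemma fracE (u : {fraction D}) : exists n d, d != 0 /\ u = n%:F / d%:F.
Proof.
elim/quotW: u => x; exists (frac x).1, (frac x).2.
have d0 := denom_ratioP x; split=> //; apply: canRL (mulfK _) _.
  by rewrite tofrac_eq0.
rewrite /tofrac; unlock FracField.tofrac; rewrite -[LHS]FracField.pi_mul.
apply/eqmodP; rewrite /= FracField.equivfE /FracField.mulf.
by rewrite !numden_Ratio ?mulf_neq0 ?oner_eq0// !mulr1 mulrC.
Qed.

(** The fraction n/d has the sign of nd = (n/d) d^2; [Q0N] forces n and d to be nonzero here. *)
Definition frac_pos (u : {fraction D}) : Prop :=
  exists n d, u = n%:F / d%:F /\ Q (n * d).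

Lemma pos_sqr (d : D) : d != 0 -> Q (d * d).
Proof. by move=> /Q_total[] Qd; [|rewrite -mulrNN]; exact: QM. Qed.

(** Independence of the representative: if n'd' > 0 > nd with n'd = nd', then n'd'd^2 - ndd'^2 is
    positive, yet it vanishes. *)
Lemma frac_posE (n d : D) : d != 0 -> frac_pos (n%:F / d%:F) <-> Q (n * d).
Proof.
move=> d0; split=> [[n' [d' [/eqP e Q']]]|]; last by exists n, d.
have nd'0 : n' * d' != 0 by apply/eqP => z; apply: Q0N; rewrite -z.
have [n'0 d'0] : n' != 0 /\ d' != 0 by apply/andP; rewrite -negb_or -mulf_eq0.
have {}e : n * d' = n' * d.
  move: e; rewrite eqr_div ?tofrac_eq0// -!tofracM tofrac_eq => /eqP e.
  by rewrite e.
have n0 : n != 0.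
  by apply/eqP => n0; move: e; rewrite n0 mul0r => /esym/eqP;
    rewrite mulf_eq0 (negbTE n'0) (negbTE d0).
have [//|QN] := Q_total (mulf_neq0 n0 d0).
case: Q0N; have := QD (QM Q' (pos_sqr d0)) (QM QN (pos_sqr d'0)).
congr Q; apply: (@etrans _ _ (n' * d * (d' * d) - n * d' * (d * d'))).
  by ring.
by rewrite e; ring.
Qed.

Lemma frac_posD u v : frac_pos u -> frac_pos v -> frac_pos (u + v).
Proof.
move=> [n [d [-> Qu]]] [n' [d' [-> Qv]]].
have d0 : d != 0 by apply/eqP => z; move: Qu; rewrite z mulr0.
have d'0 : d' != 0 by apply/eqP => z; move: Qv; rewrite z mulr0.
rewrite addf_div ?tofrac_eq0// -!tofracM -tofracD; exists (n * d' + n' * d), (d * d').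
split=> //.
have := QD (QM Qu (pos_sqr d'0)) (QM Qv (pos_sqr d0)).
by congr Q; ring.
Qed.

Lemma frac_posM u v : frac_pos u -> frac_pos v -> frac_pos (u * v).
Proof.
move=> [n [d [-> Qu]]] [n' [d' [-> Qv]]]; exists (n * n'), (d * d').
rewrite mulf_div -!tofracM; split=> //.
by have := QM Qu Qv; congr Q; ring.
Qed.

Lemma frac_pos0N : ~ frac_pos 0.
Proof.
have -> : 0 = 0%:F / 1%:F :> {fraction D} by rewrite tofrac0 mul0r.
by move/(frac_posE 0 (oner_neq0 _)); rewrite mul0r.
Qed.

Lemma frac_pos_total u : u != 0 -> frac_pos u \/ frac_pos (- u).
Proof.
have [n [d [d0 ->]]] := fracE u => u0.
have n0 : n != 0 by apply: contraNneq u0 => ->; rewrite tofrac0 mul0r.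
rewrite -mulNr -tofracN.
by have [] := Q_total (mulf_neq0 n0 d0); [left|right];
  apply/frac_posE => //; rewrite mulNr.
Qed.

Definition frac_order : field_order {fraction D} :=
  FieldOrder frac_posD frac_posM frac_pos0N frac_pos_total.

End FractionOrder.

(** * Signs of bivariate polynomials under iterated one-sided limits *)

Section IteratedGerms.
Variable R : realType.
Implicit Types (a b c : R) (p : {poly R}) (f q : {poly {poly R}}).

Lemma horner_gt0_near p a : 0 < p.[a] -> \forall x \near a^'+, 0 < p.[x].
Proof.
by have /cvg_at_right_filter/cvgr_gt := @continuous_horner R p a; exact.
Qed.

(** Once the power of X - a, positive to the right of a, is split off, the sign is that of a
    cofactor nonzero at a. *)
Lemma sign_near_right p a : p != 0 ->
  (\forall x \near a^'+, 0 < p.[x]) \/ (\forall x \near a^'+, 0 < (- p).[x]).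
Proof.
move=> p0; have [m [q + ->]] := multiplicity_XsubC p a.
rewrite p0 implyTb => q0; rewrite /root in q0.
have pow : \forall x \near a^'+, 0 < (('X - a%:P) ^+ m).[x].
  near=> x; rewrite !hornerE exprn_gt0// subr_gt0.
  by near: x; exact: nbhs_right_gt.
have key r : 0 < r.[a] -> \forall x \near a^'+, 0 < (r * ('X - a%:P) ^+ m).[x].
  move=> /horner_gt0_near; apply: filterS2 pow => x h1 h2.
  by rewrite hornerM mulr_gt0.
have [qa0|qa0|] := ltgtP 0 q.[a].
- by left; exact: key.
- by right; rewrite -mulNr; apply: key; rewrite hornerN oppr_gt0.
- by move=> e; rewrite -e eqxx in q0.
Unshelve. all: by end_near. Qed.

(* In the notation p.[y, x], the outer variable is evaluated at y. *)
Definition germ_pos a b f : Prop :=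
  \forall x \near a^'+, \forall y \near b^'+, 0 < f.[y, x].

Lemma germ_posD a b f g :
  germ_pos a b f -> germ_pos a b g -> germ_pos a b (f + g).
Proof.
apply: filterS2 => x; apply: filterS2 => y.
by rewrite !hornerE; exact: addr_gt0.
Qed.

Lemma germ_posM a b f g :
  germ_pos a b f -> germ_pos a b g -> germ_pos a b (f * g).
Proof.
apply: filterS2 => x; apply: filterS2 => y.
by rewrite !hornerE; exact: mulr_gt0.
Qed.

Lemma germ_pos0N a b : ~ germ_pos a b 0.
Proof.
by move=> /filter_ex[x] /filter_ex[y]; rewrite !horner0 ltxx.
Qed.

Lemma germ_pos_lead a b q m :
  (\forall x \near a^'+, 0 < q.[b, x]) ->
  germ_pos a b (q * ('X - b%:P%:P) ^+ m).
Proof.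
(* The swap presents q, at fixed x, as a univariate polynomial in y, so positivity at b persists to
   its right. *)
apply: filterS => x; rewrite -horner2_swapXY => /horner_gt0_near.
move=> qx; near=> y.
rewrite hornerM hornerM -horner2_swapXY mulr_gt0//.
  by near: y.
rewrite !hornerE exprn_gt0// subr_gt0.
by near: y; exact: nbhs_right_gt.
Unshelve. all: by end_near. Qed.

Lemma germ_pos_at a b f : 0 < f.[b, a] -> germ_pos a b f.
Proof.
by move=> /horner_gt0_near /germ_pos_lead => /(_ 0); rewrite expr0 mulr1.
Qed.

Lemma lead_factor b f : f != 0 ->
  exists m, exists2 q, q.[b%:P] != 0 & f = q * ('X - b%:P%:P) ^+ m.
Proof.
move=> f0; have [m [q qb fE]] := multiplicity_XsubC f b%:P.
by exists m, q => //; move: qb; rewrite f0.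
Qed.

Lemma germ_pos_total a b f : f != 0 -> germ_pos a b f \/ germ_pos a b (- f).
Proof.
move=> /(lead_factor b)[m [q q0 ->]].
have [h|h] := sign_near_right a q0; [left|right; rewrite -mulNr];
  apply: germ_pos_lead => //.
by rewrite hornerN.
Qed.

(** Positivity of q at the point (a, b) survives either order of limits, and (Y - b)^m is positive
    once Y > b. *)
Lemma germ_pos_swap a b q m :
  0 < q.[b, a] -> germ_pos b a (swapXY (q * ('X - b%:P%:P) ^+ m)).
Proof.
move=> qba; rewrite rmorphM; apply: germ_posM.
  by apply: germ_pos_at; rewrite horner2_swapXY.
near=> x; near=> y.
rewrite horner2_swapXY !hornerE exprn_gt0// subr_gt0.
by near: x; exact: nbhs_right_gt.
Unshelve. all: by end_near. Qed.

(** Write f = q (Y - b)^m with q(X, b) nonzero. Positivity at c means that q(X, b) is positive just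
    to the right of c; at each such a, q is positive at the point (a, b) itself, so both orders of
    limits agree. *)
Lemma germ_pos_near c b f : germ_pos c b f ->
  \forall a \near c^'+, germ_pos a b f /\ germ_pos b a (swapXY f).
Proof.
move=> fc; have f0 : f != 0.
  by apply/eqP => f0; move: fc; rewrite f0; exact: germ_pos0N.
have [m [q q0 fE]] := lead_factor b f0.
have [h|h] := sign_near_right c q0; last first.
  (* Otherwise f and -f would both be positive at c. *)
  have := @germ_pos_lead c b (- q) m; rewrite mulNr -fE => /(_ _)/wrap[].
    by under eq_near do rewrite hornerN.
  by move=> /(germ_posD fc); rewrite subrr => /germ_pos0N.
apply: filterS h => a qa; rewrite fE; split.
  by apply: germ_pos_lead; exact: horner_gt0_near.
exact: germ_pos_swap.
Qed.

End IteratedGerms.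

(** Harrison sets form a subbase, so convergence need only be tested on one positive element at a
    time. *)
Lemma cvg_field_order (T : Type) (G : set_system T) (L : fieldType)
    (u : T -> field_order L) (P : field_order L) : Filter G ->
  (forall x, P x -> \forall t \near G, u t x) -> u @ G --> P.
Proof.
move=> FG h A; rewrite nbhsE => -[B [oB BP] BA].
(* [D] writes the open set as a union of finite intersections; [E] is a finite family whose
   intersection contains [P]. *)
have [D DF DB] := oB; move: BP; rewrite -DB => -[_ /[dup]/DF [E EH <-] DE PE].
apply: (@filterS _ (u @ G) _ (\bigcap_(i in [set` E : {fset set _}]) i)).
  by move=> Q EQ; apply: BA; rewrite -DB; exists (\bigcap_(i in [set` E]) i).
apply: (@filter_bigI _ _ (E : {fset set (field_order L)}) id) => i iE.
have /set_mem[x x0 xi] := EH _ iE; rewrite -xi.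
by apply: h; have := PE _ iE; rewrite -xi.
Qed.

(** The embedding of the residue field is injective, so the place vanishes exactly on I(P); q = 1
    shows that the right-hand side puts x in A(P). *)
Lemma place_eq0 (R : realType) (L : fieldType) (P : field_order L) (x : L) :
  place R P x = Some 0 <->
  forall q : rat, 0 < q -> P (ratr q + x) /\ P (ratr q - x).
Proof.
rewrite /place; case: insubP => [b bx <-|/negP xN] /=; last first.
  split=> // h; case: xN; apply/asboolP; exists 1 => //; exact: h.
split=> [[/eqP]|h].
  by rewrite fmorph_eq0 residue_eq0 => /asboolP.
congr Some; apply/eqP; rewrite fmorph_eq0 residue_eq0; exact/asboolP.
Qed.

Lemma le0_of_right_limits0 (R : realType) (g : R -> R) :
  (forall c e, 0 < e -> \forall a \near c^'+, g a < e) -> exists a, g a <= 0.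
Proof.
move=> h.
pose F (n : nat) : set R := [set a | g a < n.+1%:R^-1]^°.
have FP n : open (F n) /\ dense (F n).
  split; first exact: open_interior.
  move=> O [c Oc] oO.
  have n0 : 0 < n.+1%:R^-1 :> R by rewrite invr_gt0.
  have Oc' : \forall a \near c^'+, O a.
    by apply: cvg_within; exact: open_nbhs_nbhs.
  have [r /= r0 rh] := filterI (h c _ n0) Oc'.
  have near_r a : c < a < c + r -> g a < n.+1%:R^-1 /\ O a.
    move=> /andP[ca acr]; apply: rh => //=.
    by rewrite distrC gtr0_norm ?subr_gt0// ltrBlDl.
  (* The midpoint of ]c, c + r[ lies in [O] and is interior to {g < 1/(n+1)}. *)
  exists (c + r / 2); split.
    by apply: (near_r _ _).2; apply/andP; split; lra.
  have : open_nbhs (c + r / 2) `]c, c + r[.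
    by split; [exact: interval_open|rewrite /= in_itv /=; apply/andP; split; lra].
  move=> /open_nbhs_nbhs; apply: filterS => a /=; rewrite in_itv /=.
  by move=> /near_r[].
have /(_ setT)[] := Baire FP; [by exists 0|exact: openT|].
move=> a [_ aF]; exists a; rewrite leNgt; apply/negP => ga.
have [n _ /(_ n (leqnn n)) /= nga] : \forall n \near \oo, n.+1%:R^-1 < g a.
  exact: near_infty_natSinv_lt (PosNum ga).
have := interior_subset (aF n I).
by move=> /= /(lt_trans nga); rewrite ltxx.
Qed.

(** * The orders P_a and Q_a of R(X,Y), their limits and their places *)

Section PlanarOrders.
Variable R : realType.
Implicit Types (a c : R) (f d s : {poly {poly R}}).
Local Notation K := (ratfun2 R).

(* The order with 0 < Y << X - a << 1. *)
Definition order_Xa a : field_order K :=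
  frac_order (@germ_posD R a 0) (@germ_posM R a 0) (@germ_pos0N R a 0)
    (@germ_pos_total R a 0).

Lemma swap_posD a (f g : {poly {poly R}}) : germ_pos 0 a (swapXY f) ->
  germ_pos 0 a (swapXY g) -> germ_pos 0 a (swapXY (f + g)).
Proof. by rewrite rmorphD; exact: germ_posD. Qed.

Lemma swap_posM a (f g : {poly {poly R}}) : germ_pos 0 a (swapXY f) ->
  germ_pos 0 a (swapXY g) -> germ_pos 0 a (swapXY (f * g)).
Proof. by rewrite rmorphM; exact: germ_posM. Qed.

Lemma swap_pos0N a : ~ germ_pos 0 a (swapXY 0).
Proof. by rewrite rmorph0; exact: germ_pos0N. Qed.

Lemma swap_pos_total a (f : {poly {poly R}}) : f != 0 ->
  germ_pos 0 a (swapXY f) \/ germ_pos 0 a (swapXY (- f)).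
Proof. by rewrite -swapXY_eq0 rmorphN; exact: germ_pos_total. Qed.

(* The order with 0 < X - a << Y << 1. *)
Definition order_aX a : field_order K :=
  frac_order (@swap_posD a) (@swap_posM a) (@swap_pos0N a) (@swap_pos_total a).

Lemma order_near c (u : K) : order_Xa c u ->
  \forall a \near c^'+, order_Xa a u /\ order_aX a u.
Proof.
move=> [n [d [uE nd]]]; have := germ_pos_near nd; apply: filterS => a [h1 h2].
by split; exists n, d.
Qed.

Lemma cvg_order_Xa c : order_Xa a @[a --> c^'+] --> order_Xa c.
Proof.
by apply: cvg_field_order => x /order_near; apply: filterS => a [].
Qed.

Lemma cvg_order_aX c : order_aX a @[a --> c^'+] --> order_Xa c.
Proof.
by apply: cvg_field_order => x /order_near; apply: filterS => a [].
Qed.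

Lemma order_XaE a (f d : {poly {poly R}}) : d != 0 ->
  order_Xa a (tofrac f / tofrac d) <-> germ_pos a 0 (f * d).
Proof.
by apply: frac_posE; [exact: germ_posD|exact: germ_posM|exact: germ_pos0N|
  exact: germ_pos_total].
Qed.

Lemma order_aXE a (f d : {poly {poly R}}) : d != 0 ->
  order_aX a (tofrac f / tofrac d) <-> germ_pos 0 a (swapXY (f * d)).
Proof.
by apply: frac_posE; [exact: swap_posD|exact: swap_posM|exact: swap_pos0N|
  exact: swap_pos_total].
Qed.

(** The outer ['X] is Y and the constant polynomial below is X - a, so this is Y/(X - a). *)
Definition slope a : K := tofrac 'X / tofrac ('X - a%:P)%:P.

Lemma slope_denom_neq0 a : ('X - a%:P)%:P != 0 :> {poly {poly R}}.
Proof. by rewrite polyC_eq0 polyXsubC_eq0. Qed.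

Lemma ratr_tofrac (q : rat) : ratr q = tofrac (ratr q)%:P%:P :> K.
Proof.
pose F : {rmorphism R -> K} := @tofrac _ \o polyC \o polyC.
by rewrite -[RHS]/(F (ratr q)) /ratr fmorph_div /= !rmorph_int.
Qed.

Lemma ratrD_slope a (q : rat) (s : {poly {poly R}}) :
  ratr q + tofrac s / tofrac ('X - a%:P)%:P =
  tofrac ((ratr q)%:P%:P * ('X - a%:P)%:P + s) / tofrac ('X - a%:P)%:P :> K.
Proof.
rewrite ratr_tofrac tofracD tofracM mulrDl mulfK// tofrac_eq0.
exact: slope_denom_neq0.
Qed.

Lemma place_slope_Xa a : place R (order_Xa a) (slope a) = Some 0.
Proof.
(* [s] stands for Y or -Y; at Y = 0 the numerator times the denominator is q (X - a)^2. *)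
have small (q : rat) (s : {poly {poly R}}) : 0 < q -> s.[0] = 0 ->
    order_Xa a (ratr q + tofrac s / tofrac ('X - a%:P)%:P).
  move=> q0 s0; rewrite ratrD_slope; apply/order_XaE.
    exact: slope_denom_neq0.
  have := @germ_pos_lead R a 0
    (((ratr q)%:P%:P * ('X - a%:P)%:P + s) * ('X - a%:P)%:P) 0.
  rewrite expr0 mulr1; apply; near=> x.
  have xa : 0 < x - a by rewrite subr_gt0; near: x; exact: nbhs_right_gt.
  rewrite !(hornerE, s0).
  by rewrite mulr_gt0// mulr_gt0// ltr0q.
apply/place_eq0 => q q0; split; rewrite /slope.
  by apply: small => //; rewrite hornerX.
by rewrite -mulNr -tofracN; apply: small => //; rewrite hornerN hornerX oppr0.
Unshelve. all: by end_near. Qed.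

(** In Q_a one has 0 < X - a < Y, so Y/(X - a) exceeds 1 and the bound with q = 1 fails. *)
Lemma place_slope_aX a : place R (order_aX a) (slope a) <> Some 0.
Proof.
move=> /place_eq0/(_ 1 ltr01)[_]; rewrite /slope -mulNr -tofracN ratrD_slope.
move=> /order_aXE => /(_ (slope_denom_neq0 a)) h.
suff /(germ_posD h) : germ_pos 0 a (swapXY
    (- (((ratr 1)%:P%:P * ('X - a%:P)%:P - 'X) * ('X - a%:P)%:P))).
  by rewrite -rmorphD subrr rmorph0; exact: germ_pos0N.
near=> y; near=> x; rewrite horner2_swapXY rmorph1 !hornerE.
have xa : 0 < x - a by rewrite subr_gt0; near: x; exact: nbhs_right_gt.
(* Here y is fixed before x, so x can be taken within y of a. *)
have xy : x - a < y.
  near: x; apply: nbhs_right_ltDr.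
  by near: y; exact: nbhs_right_gt.
nra.
Unshelve. all: by end_near. Qed.

End PlanarOrders.

Theorem corollary4p11 (R : realType) :
  ~ metrizable R (space_of_places R (ratfun2 R)).
Proof.
move=> [M [f [g [fK gK fc _]]]].
pose mu P : M := f (place_of R P).
have muc : continuous mu.
  move=> P; apply: (@continuous_comp _ _ _
    (@place_of R (ratfun2 R) : _ -> space_of_places R (ratfun2 R)) f).
    move: P; apply/continuousP => U /open_space_of_places; exact.
  exact: fc.
pose dist a := mdist (mu (order_Xa a)) (mu (order_aX a)).
have [|a] := @le0_of_right_limits0 R dist.
  move=> c e e0; have e20 : 0 < e / 2 by rewrite divr_gt0.
  have h1 : mu (order_Xa a) @[a --> c^'+] --> mu (order_Xa c).
    exact: (cvg_comp (@order_Xa R) mu (@cvg_order_Xa R c) (muc _)).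
  have h2 : mu (order_aX a) @[a --> c^'+] --> mu (order_Xa c).
    exact: (cvg_comp (@order_aX R) mu (@cvg_order_aX R c) (muc _)).
  move/metricType_numDomainType.cvgrPdist_lt : h1 => /(_ _ e20).
  move/metricType_numDomainType.cvgrPdist_lt : h2 => /(_ _ e20).
  apply: filterS2 => a h2 h1; rewrite [e]splitr.
  (* Both points lie within e/2 of their common limit, the image of P_c. *)
  rewrite (le_lt_trans (metric_triangle _ (mu (order_Xa c)) _))//.
  by rewrite ltrD// metric_sym.
(* By injectivity of [f], distance zero would make the two places equal, which their values at
   [slope a] rule out. *)
apply/negP; rewrite -ltNge mdist_gt0; apply/eqP => /(can_inj fK).
move=> /(congr1 (fun l : real_place R (ratfun2 R) => sval l)) e.
have {}e : place R (order_Xa a) = place R (order_aX a) := e.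
by apply: (@place_slope_aX R a); rewrite -e place_slope_Xa.
Qed.
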